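(* Let $G=(V,E)$ be a finite connected graph with $n=|V|\ge 2$ vertices $v_1,\dots,v_n$ and distance matrix $D=(d(v_i,v_j))_{i,j=1}^n$. Let $w\in\mathbb{R}^n_{>0}$ be an arbitrary vector with strictly positive entries and let $K=\min_i w_i>0$. Then $$\operatorname{diam}(G)\le \frac{\|Dw\|_{\ell^\infty}}{n}\cdot\frac{8}{K}$$ and $$\lambda_1(G)\ge \frac{1}{8\,\|Dw\|_{\ell^\infty}}\,K.$$
   Context: Graphs are finite, simple, undirected and unweighted; $d(u,v)$ is the shortest-path (combinatorial) distance, $\operatorname{diam}(G)=\max_{u,v}d(u,v)$, and $\|x\|_{\ell^\infty}=\max_i|x_i|$. The quantity $\lambda_1(G)$ is the smallest nontrivial eigenvalue of the graph Laplacian (degree matrix minus adjacency matrix), i.e. $$\lambda_1(G)=\inf\left\{\frac{\sum_{(u,v)\in E}(f(u)-f(v))^2}{\sum_{v\in V}f(v)^2}: f:V\to\mathbb{R},\ f\not\equiv 0,\ \sum_{v\in V}f(v)=0\right\},$$ where each undirected edge is counted once. *)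

(* Defs.v *)
From HB Require Import structures.
From mathcomp Require Import all_boot all_order all_algebra.
From mathcomp Require Import all_classical all_reals all_analysis.

Set Implicit Arguments.
Unset Strict Implicit.
Unset Printing Implicit Defensive.

Import Order.TTheory GRing.Theory Num.Theory.
Import numFieldNormedType.Exports.

Local Open Scope ring_scope.
Local Open Scope classical_set_scope.

Record sgraph (V : finType) := SGraph {
  adj :> rel V;
  adj_sym : symmetric adj;
  adj_irr : irreflexive adj }.

Section Graph.
Variables (V : finType) (G : sgraph V).

Definition gconnected : Prop := forall x y : V, connect G x y.

Definition has_walk (x y : V) : pred nat :=
  fun k => [exists p : k.-tuple V, path G x p && (last x p == y)].

(* The value 0 for unreachable pairs is a junk value; it never occurs in a
   connected graph. *)
Definition gdist (x y : V) : nat :=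
  if pselect (exists k, has_walk x y k) is left xy then ex_minn xy else 0%N.

Definition diam : nat := \max_(x : V) \max_(y : V) gdist x y.

Variable R : realType.

(* The double sum ranges over ordered adjacent pairs, hence meets every
   undirected edge twice; the factor 1/2 makes each edge count once. *)
Definition edge_energy (f : V -> R) : R :=
  2^-1 * \sum_(x : V) \sum_(y : V | G x y) (f x - f y) ^+ 2.

Definition rayleigh (f : V -> R) : R :=
  edge_energy f / \sum_(x : V) f x ^+ 2.

Definition lambda1 : R :=
  inf [set rayleigh f | f in
        [set f : V -> R | (exists x, f x != 0) /\ \sum_(x : V) f x = 0]].

Definition distmx n (v : 'I_n -> V) : 'M[R]_n :=
  \matrix_(i, j) (gdist (v i) (v j))%:R.

End Graph.

Arguments lambda1 {V} G R.
Arguments distmx {V} G R {n} v.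

(* Main.v *)
Require Import Defs.
From mathcomp Require Import all_boot all_order all_algebra.
From mathcomp Require Import all_classical all_reals all_analysis.
From mathcomp Require Import lra.

Set Implicit Arguments.
Unset Strict Implicit.
Unset Printing Implicit Defensive.

Import Order.TTheory GRing.Theory Num.Theory.
Import numFieldNormedType.Exports.

Local Open Scope ring_scope.

(** The distance matrix is used only to bound [n * diam G]. If [x] and [y] are
    at distance [diam G], the triangle inequality gives
    [diam G <= gdist x z + gdist y z] for each of the [n] vertices [z]; adding
    these up, one of the two rows sums to at least [n * diam G / 2]. As the
    weights are at least [K], this entry of [D w] is at least
    [K * n * diam G / 2] ([weighted_diam_le]), which implies the first
    inequality.

    The second one follows from a spectral gap of order [1 / (n * diam G)]
    ([poincare_diam]). A function [f] with zero mean takes, somewhere, a value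
    of sign opposite to its value at the vertex [x] where [|f|] is maximal.
    Along a simple path of at most [diam G] edges between the two vertices,
    [f] changes by at least [|f x|], so by the Cauchy-Schwarz inequality
    [f x ^+ 2] is at most [diam G] times the energy of [f] along that path,
    while the sum of the squares of [f] is at most [n * f x ^+ 2]. The
    constant [8] leaves room for both factors [2]: the one of
    [weighted_diam_le], and the one lost by comparing the energy along a path
    with a sum over ordered pairs, in which every edge of the graph occurs
    twice. *)

(** * Shortest walks *)

Section Distance.
Variables (V : finType) (G : sgraph V).

Lemma gdist_le_path (x : V) (p : seq V) :
  path G x p -> (gdist G x (last x p) <= size p)%N.
Proof.
move=> Gp.
have walk : has_walk G x (last x p) (size p).
  by apply/existsP; exists (in_tuple p); rewrite /= Gp eqxx.
rewrite /gdist; case: pselect => [ex|//].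
by case: ex_minnP => m _; apply.
Qed.

Lemma gdist_path (x y : V) : connect G x y ->
  exists p, [/\ path G x p, last x p = y & size p = gdist G x y].
Proof.
move=> /connectP[q Gq ->].
have ex : exists k, has_walk G x (last x q) k.
  exists (size q); apply/existsP; exists (in_tuple q).
  by rewrite /= Gq eqxx.
rewrite /gdist; case: pselect => [ex'|//].
case: ex_minnP => m /existsP[p /andP[Gp /eqP lastp]] _.
by exists p; rewrite size_tuple.
Qed.

(** Shortening a shortest walk cannot lose its length, so geodesics are
    simple paths; only the resulting bound on the length is recorded. *)
Lemma gdist_upath (x y : V) : connect G x y ->
  exists p, [/\ path G x p, last x p = y, uniq (x :: p)
              & (size p <= gdist G x y)%N].
Proof.
move=> /gdist_path[p [Gp <- <-]].
case/shortenP: Gp => q Gq uq sub_qp.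
by exists q; split=> //; apply: uniq_leq_size; [case/andP: uq|].
Qed.

Lemma gdist_triangle (x y z : V) : gconnected G ->
  (gdist G x y <= gdist G x z + gdist G y z)%N.
Proof.
move=> conn.
have [p [Gp lastp <-]] := gdist_path (conn x z).
have [q [Gq lastq <-]] := gdist_path (conn y z).
have Gr : path G z (rev (belast y q)).
  rewrite -lastq rev_path; apply: sub_path Gq => a b.
  by rewrite /= adj_sym.
have lastr : last z (rev (belast y q)) = y.
  by rewrite -lastq; case: q {Gq lastq Gr} => //= a q; rewrite rev_cons last_rcons.
have := @gdist_le_path x (p ++ rev (belast y q)).
by rewrite cat_path last_cat lastp Gp Gr lastr size_cat size_rev size_belast => ->.
Qed.

Lemma gdist_le_diam (x y : V) : (gdist G x y <= diam G)%N.
Proof.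
apply: leq_trans (leq_bigmax x).
exact: (@leq_bigmax _ (fun y => gdist G x y)).
Qed.

End Distance.

(** * Weighted row sums of the distance matrix *)

Lemma norm_entry_le (R : realType) m n (A : 'M[R]_(m, n)) i j :
  `|A i j| <= `|A|.
Proof.
rewrite [leRHS]/Num.Def.normr /= mx_normrE.
exact: (le_bigmax _ (fun ij : 'I_m * 'I_n => `|A ij.1 ij.2|) (i, j)).
Qed.

Section WeightedDiam.
Variables (R : realType) (V : finType) (G : sgraph V) (n : nat).
Variables (v : 'I_n -> V) (w : 'cV[R]_n) (K : R).
Hypotheses (conn : gconnected G) (cardV : #|V| = n) (v_inj : injective v).
Hypotheses (K_gt0 : 0 < K) (wK : forall i, K <= w i 0).

Lemma weighted_gdist_le (x y : V) :
  K * n%:R * (gdist G x y)%:R <= 2 * `|distmx G R v *m w|.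
Proof.
have v_surj z : exists i, z = v i.
  have /codomP[i ->] : z \in codom v by rewrite inj_card_onto // card_ord cardV.
  by exists i.
have [i ->] := v_surj x; have [j ->] := v_surj y.
set d := (gdist G (v i) (v j))%:R.
have row_sums : K * n%:R * d <=
    (distmx G R v *m w) i 0 + (distmx G R v *m w) j 0.
  rewrite !mxE -big_split /=.
  have -> : K * n%:R * d = \sum_(k < n) K * d.
    by rewrite sumr_const card_ord mulrAC mulr_natr.
  apply: ler_sum => k _; rewrite !mxE -mulrDl mulrC -natrD.
  by apply: ler_pM; rewrite ?ler_nat ?ler0n ?(ltW K_gt0) // gdist_triangle.
have Mi := le_trans (ler_norm _) (norm_entry_le (distmx G R v *m w) i 0).
have Mj := le_trans (ler_norm _) (norm_entry_le (distmx G R v *m w) j 0).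
lra.
Qed.

Lemma weighted_diam_le :
  K * n%:R * (diam G)%:R <= 2 * `|distmx G R v *m w|.
Proof.
rewrite /diam; pose P m := K * n%:R * m%:R <= 2 * `|distmx G R v *m w|.
have P0 : P 0%N by rewrite /P mulr0 mulr_ge0.
have Pmax a b : P a -> P b -> P (maxn a b) by rewrite /maxn; case: ifP.
apply: (big_ind P) => // x _; apply: (big_ind P) => // y _.
exact: weighted_gdist_le.
Qed.

End WeightedDiam.

(** * A Poincare inequality in terms of the diameter *)

Section Poincare.
Variables (R : realType) (V : finType) (G : sgraph V) (f : V -> R).

Let local_energy (x : V) : R := \sum_(y | G x y) (f x - f y) ^+ 2.

Let local_energy_ge0 x : 0 <= local_energy x.
Proof. by apply: sumr_ge0 => y _; rewrite sqr_ge0. Qed.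

#[local] Hint Resolve local_energy_ge0 : core.

Lemma edge_energyE : 2 * edge_energy G f = \sum_x local_energy x.
Proof. by rewrite /edge_energy mulrA divff ?mul1r. Qed.

Lemma edge_energy_ge0 : 0 <= edge_energy G f.
Proof. by rewrite -(@pmulr_rge0 _ 2) // edge_energyE sumr_ge0. Qed.

(** The Cauchy-Schwarz inequality for the telescoping sum of the increments of
    [f]. Each increment is charged to the vertex that it starts from, so that
    repeated vertices are the only way to count an ordered edge twice. *)
Lemma path_increment_sqr (x : V) (p : seq V) : path G x p ->
  (f x - f (last x p)) ^+ 2
    <= (size p)%:R * \sum_(z <- x :: p) local_energy z.
Proof.
elim: p x => [|y p IH] x /=; first by rewrite subrr expr0n mul0r.
case/andP=> Gxy Gp; move/IH: Gp; rewrite [in X in _ -> X]big_cons.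
set T := \sum_(z <- y :: p) _; set b := f y - _; set k := (size p)%:R => bkT.
have T_ge0 : 0 <= T by apply: sumr_ge0.
have k_ge0 : 0 <= k by rewrite ler0n.
have xy_le : (f x - f y) ^+ 2 <= local_energy x.
  rewrite /local_energy (bigD1 y) //= lerDl.
  by apply: sumr_ge0 => z _; rewrite sqr_ge0.
have -> : f x - f (last y p) = (f x - f y) + b by rewrite /b addrA subrK.
rewrite -natr1 -/k.
set a := f x - f y in xy_le *.
apply: (@le_trans _ _ ((k + 1) * (a ^+ 2 + T))); last first.
  by rewrite ler_wpM2l ?lerD2r // addr_ge0.
have [k0|k_neq0] := eqVneq k 0.
  have b0 : b = 0.
    by apply/eqP; rewrite -sqrf_eq0 eq_le sqr_ge0 andbT (le_trans bkT) // k0 mul0r.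
  by rewrite k0 b0 addr0 add0r mul1r lerDl.
have k_gt0 : 0 < k by rewrite lt_def k_neq0.
(* After expansion the claim is [2ab <= k a^2 + T]; multiplied by [k], it is
   implied by [0 <= (ka - b)^2]. *)
have sq_ge0 : 0 <= (k * a - b) ^+ 2 by rewrite sqr_ge0.
have : 0 <= k * (k * a ^+ 2 + T - 2 * a * b) by nra.
rewrite pmulr_rge0 // => ?; nra.
Qed.

Lemma gdist_increment_sqr (x y : V) : connect G x y ->
  (f x - f y) ^+ 2 <= (gdist G x y)%:R * (2 * edge_energy G f).
Proof.
move=> /gdist_upath[p [Gp <- up lep]].
apply: le_trans (path_increment_sqr Gp) _.
apply: ler_pM; rewrite ?ler0n ?ler_nat ?sumr_ge0 //.
rewrite edge_energyE big_uniq //= [leRHS](bigID (mem (x :: p))) /= lerDl.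
exact: sumr_ge0.
Qed.

(** Otherwise [f x * f y] would be positive for every [y], but these products
    add up to zero. *)
Lemma sum0_opposite_sign (x : V) : \sum_z f z = 0 ->
  exists y, f x * f y <= 0.
Proof.
move=> sum0; apply: contrapT => no_y.
have pos y : 0 < f x * f y by rewrite ltNge; apply/negP => h; apply: no_y; exists y.
have : \sum_z f x * f z = 0 by rewrite -mulr_sumr sum0 mulr0.
move/eqP; rewrite psumr_eq0 => [/allP/(_ x)|z _]; last exact: ltW.
by rewrite mem_index_enum gt_eqF // => /(_ isT).
Qed.

Lemma poincare_diam : gconnected G -> \sum_x f x = 0 ->
  \sum_x f x ^+ 2 <= #|V|%:R * (diam G)%:R * (2 * edge_energy G f).
Proof.
move=> conn sum0.
have E_ge0 : 0 <= 2 * edge_energy G f by rewrite mulr_ge0 ?edge_energy_ge0.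
have [z0 _|V0] := pickP (@predT V); last first.
  rewrite big_pred0 => [|z]; last exact: V0.
  exact: mulr_ge0 (mulr_ge0 (ler0n _ _) (ler0n _ _)) E_ge0.
have [x _ xmax] := @arg_maxP _ _ _ z0 predT (fun z => f z ^+ 2) isT.
have [y fxy] := sum0_opposite_sign x sum0.
apply: (@le_trans _ _ (\sum_(z : V) f x ^+ 2)).
  by apply: ler_sum => z _; exact: xmax.
rewrite sumr_const -[_ *+ _]mulr_natl cardT -cardE -mulrA ler_wpM2l ?ler0n //.
apply: (@le_trans _ _ ((f x - f y) ^+ 2)); first by nra.
apply: le_trans (gdist_increment_sqr (conn x y)) _.
by rewrite ler_wpM2r // ler_nat gdist_le_diam.
Qed.

End Poincare.

(** * The spectral gap as an infimum *)

(** Two distinct vertices are needed for a nonzero function of zero mean to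
    exist, hence for the infimum not to be the default value. *)
Lemma lambda1_ge (R : realType) (V : finType) (G : sgraph V) (c : R) :
  (2 <= #|V|)%N ->
  (forall f : V -> R, \sum_x f x = 0 ->
     c * \sum_x f x ^+ 2 <= edge_energy G f) ->
  c <= lambda1 G R.
Proof.
move=> /card_gt1P[x [y [_ _ xy]]] cE.
apply: lb_le_inf.
  pose f z : R := (z == x)%:R - (z == y)%:R.
  exists (rayleigh G f), f => //; split.
    by exists x; rewrite /f eqxx (negbTE xy) subr0 oner_neq0.
  have sum_delta a : \sum_z (z == a)%:R = 1 :> R.
    by under eq_bigr do rewrite mulrb; rewrite -big_mkcond big_pred1_eq.
  by rewrite /f sumrB !sum_delta subrr.
move=> _ [f [[z fz] sum0] <-].
have S_gt0 : 0 < \sum_x f x ^+ 2.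
  rewrite (bigD1 z) //= ltr_pwDl ?sumr_ge0 // => [|u _]; last by rewrite sqr_ge0.
  by rewrite exprn_even_gt0.
by rewrite /rayleigh ler_pdivlMr // cE.
Qed.

(* The norm of a matrix is the library's entrywise maximum norm; K is the
   minimum of the entries of w. *)
Theorem theorem5 (R : realType) (V : finType) (G : sgraph V) (n : nat)
    (v : 'I_n -> V) (w : 'cV[R]_n) (K : R) :
  gconnected G ->
  #|V| = n -> (2 <= n)%N -> injective v ->
  (forall i, 0 < w i 0) ->
  (forall i, K <= w i 0) -> (exists i, w i 0 = K) ->
  (diam G)%:R <= `|distmx G R v *m w| / n%:R * (8 / K) /\
  lambda1 G R >= 1 / (8 * `|distmx G R v *m w|) * K.
Proof.
move=> conn cardV n_ge2 v_inj w_gt0 wK [i0 wi0].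
have K_gt0 : 0 < K by rewrite -wi0.
have n_gt0 : 0 < n%:R :> R by rewrite ltr0n (leq_trans _ n_ge2).
have := weighted_diam_le conn cardV v_inj K_gt0 wK.
set M := `|_|; set d := (diam G)%:R => KndM.
have M_ge0 : 0 <= M by exact: normr_ge0.
split.
  by rewrite mulrACA -invfM ler_pdivlMr ?mulr_gt0 //; nra.
apply: lambda1_ge => [|f sum0]; first by rewrite cardV.
have := poincare_diam conn sum0; rewrite cardV -/d.
have := edge_energy_ge0 G f.
set E := edge_energy G f; set S := \sum_x _ => E_ge0 SE.
(* If [M] were zero, the bound would be [0] by the convention [0^-1 = 0]. *)
have [->|M_neq0] := eqVneq M 0; first by rewrite mulr0 invr0 mulr0 !mul0r.
have M_gt0 : 0 < M by rewrite lt_def M_neq0.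
rewrite mul1r -mulrA mulrC ler_pdivrMr ?mulr_gt0 //.
have KSE : K * S <= K * (n%:R * d * (2 * E)) by rewrite ler_wpM2l // ltW.
have KndE : K * n%:R * d * (2 * E) <= 2 * M * (2 * E).
  by rewrite ler_wpM2r // mulr_ge0.
nra.
Qed.
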